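(* Let $\eta\in(0,1/2)$. For all integers $d\ge6$, $N\ge1$ and every $\mathbf a\in\mathcal W(d,N)$, the proportion of pairs $(\mathbf v_1,\mathbf v_2)\in\mathcal T_{\mathbf a,\mathcal V^2}$ satisfying $$\operatorname{dist}_d(\mathbf a,\mathbf v_1),\ \operatorname{dist}_d(\mathbf a,\mathbf v_2)\in\Bigl[\sqrt{B_{\mathbf a,\mathcal V}}-\tfrac1{d^\eta},\sqrt{B_{\mathbf a,\mathcal V}}+\tfrac1{d^\eta}\Bigr]\quad\text{and}\quad \operatorname{dist}_d(\mathbf v_1,\mathbf v_2)\in\Bigl[\tfrac1{\sqrt2}-\tfrac1{d^\eta},\tfrac1{\sqrt2}+\tfrac1{d^\eta}\Bigr]$$ is at least $1-\dfrac{3}{d^{1-2\eta}}$.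
   Context: $\mathcal W(d,N)=\{0,1,\dots,N\}^d$, $\mathcal V=\{0,N\}^d$ (vertices of $[0,N]^d$). $\operatorname{dist}_d(\mathbf u,\mathbf v)=\frac{1}{\sqrt d\,N}\bigl(\sum_j(u_j-v_j)^2\bigr)^{1/2}$. $B_{\mathbf a,\mathcal V}=\frac{1}{2^d}\sum_{\mathbf v\in\mathcal V}\operatorname{dist}_d^2(\mathbf a,\mathbf v)=\frac12-\frac{a_1+\cdots+a_d}{dN}+\frac{a_1^2+\cdots+a_d^2}{dN^2}$. $\mathcal T_{\mathbf a,\mathcal V^2}\subset\mathcal V^2$ is the set of pairs $(\mathbf v_1,\mathbf v_2)$ such that $\mathbf a,\mathbf v_1,\mathbf v_2$ are distinct (forming a non-degenerate triangle). *)

(* Defs.v *)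
From HB Require Import structures.
From mathcomp Require Import all_boot all_order all_algebra.
From mathcomp Require Import reals exp.

Set Implicit Arguments.
Unset Strict Implicit.
Unset Printing Implicit Defensive.

Import Order.TTheory GRing.Theory Num.Theory.
Local Open Scope ring_scope.

Definition cube (d N : nat) : finType := {ffun 'I_d -> 'I_N.+1}.

Definition vertices (d N : nat) : {set cube d N} :=
  [set v : cube d N | [forall j, (v j == 0%N :> nat) || (v j == N :> nat)]].

Definition ndist (R : realType) (d N : nat) (u v : cube d N) : R :=
  (Num.sqrt d%:R * N%:R)^-1 *
  Num.sqrt (\sum_(j < d) ((u j)%:R - (v j)%:R) ^+ 2).

Definition mean_sq_dist (R : realType) (d N : nat) (a : cube d N) : R :=
  (2 ^+ d)^-1 * \sum_(v in vertices d N) ndist R a v ^+ 2.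

(* Ordered pairs of vertices; "triangle" only asks for three distinct points. *)
Definition triangles (d N : nat) (a : cube d N) : {set cube d N * cube d N} :=
  [set p in setX (vertices d N) (vertices d N) |
    [&& a != p.1, a != p.2 & p.1 != p.2]].

Definition within (R : realType) (c r x : R) : bool := x \in `[c - r, c + r].

Definition near_isosceles (R : realType) (eta : R) (d N : nat) (a : cube d N) :
    {set cube d N * cube d N} :=
  let r := 1 / (d%:R `^ eta) in
  [set p in triangles a |
    [&& within (Num.sqrt (mean_sq_dist R a)) r (ndist R a p.1),
        within (Num.sqrt (mean_sq_dist R a)) r (ndist R a p.2)
      & within (1 / Num.sqrt 2) r (ndist R p.1 p.2)]].

(* Main.v *)
Require Import Defs.
From HB Require Import structures.
From mathcomp Require Import all_boot all_order all_algebra.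
From mathcomp Require Import reals exp.
From mathcomp Require Import ring lra zify.

Set Implicit Arguments.
Unset Strict Implicit.
Unset Printing Implicit Defensive.

Import Order.TTheory GRing.Theory Num.Theory.
Local Open Scope ring_scope.

(** On a uniformly random vertex [v], the coordinate signs [vsign v j] are
    orthonormal and [(a j - v j)^2] is affine in [vsign v j]; hence the squared
    distance from [a] to [v] has mean [B] and variance at most [B / (2 d)].
    Since [|x^2 - B| >= sqrt B * |x - sqrt B|] for [x >= 0], Chebyshev's
    inequality bounds the proportion of vertices whose distance to [a] is not
    within [r] of [sqrt B] by [1 / (2 d r^2)].  For [a] a vertex, [B = 1/2], so
    the same bound controls the third side of the triangle.  A union bound gives
    at most [3/2 * 4^d / (d r^2)] bad pairs, while at least half of the [4^d]
    pairs of vertices are non-degenerate as soon as [6 <= 2^d]. *)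

(** * Vertices of the grid and coordinate reflections *)

Section Vertices.
Variables (d N : nat).
Hypothesis N_gt0 : (0 < N)%N.
Implicit Types (u v a : cube d N) (j : 'I_d).

Lemma verticesP v :
  reflect (forall j, v j = 0%N :> nat \/ v j = N :> nat) (v \in vertices d N).
Proof.
rewrite inE; apply: (iffP forallP) => h j.
  by case/orP: (h j) => /eqP; [left | right].
by case: (h j) => ->; rewrite eqxx ?orbT.
Qed.

(** A vertex is an independent choice from a two-point set at each coordinate; [N_gt0] keeps the two
    points distinct. *)
Lemma card_vertices : #|vertices d N| = (2 ^ d)%N.
Proof.
pose F (_ : 'I_d) := pred2 (ord0 : 'I_N.+1) ord_max.
have -> : #|vertices d N| = #|family F|.
  apply: eq_card => v; apply/verticesP/familyP => h j.
    by rewrite !inE -!val_eqE /=; case: (h j) => ->; rewrite eqxx ?orbT.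
  by have := h j; rewrite !inE -!val_eqE /= => /orP[] /eqP; [left | right].
rewrite card_family /image_mem (@eq_map _ _ _ (fun=> 2%N)); last first.
  by move=> j; rewrite card2 -val_eqE /= eq_sym -lt0n N_gt0.
by rewrite -[in RHS](size_enum_ord d); elim: (enum _) => //= x s ->;
  rewrite expnS.
Qed.

(** Reflection in the hyperplane x_j = N/2, since [rev_ord] sends k to N - k. Reindexing sums over
    vertices by it produces the cancellations below. *)
Definition flip j v : cube d N :=
  [ffun k => if k == j then rev_ord (v k) else v k].

Lemma flipK j : involutive (flip j).
Proof.
by move=> v; apply/ffunP=> k; rewrite !ffunE; case: eqP => // _; rewrite rev_ordK.
Qed.

Lemma flip_vertices j v : (flip j v \in vertices d N) = (v \in vertices d N).
Proof.
suff h w : w \in vertices d N -> flip j w \in vertices d N.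
  by apply/idP/idP => [/h|/h //]; rewrite flipK.
move/verticesP=> wP; apply/verticesP => k; rewrite ffunE.
by case: eqP => // _; case: (wP k) => /= ->; [right | left];
  rewrite subSS ?subn0 ?subnn.
Qed.

(** * First and second moments of the squared distance to a random vertex *)

Section Moments.
Variable R : realFieldType.

Definition vsign v j : R := if v j == 0%N :> nat then 1 else -1.

Lemma vsign_sqr v j : vsign v j * vsign v j = 1.
Proof. by rewrite /vsign; case: ifP => _; ring. Qed.

Lemma vsign_flip i v j : v \in vertices d N ->
  vsign (flip i v) j = if j == i then - vsign v j else vsign v j.
Proof.
move/verticesP => vP; rewrite /vsign ffunE; case: (j =P i) => // _.
case: (vP j) => /= ->; rewrite subSS.
  by rewrite subn0 eqxx -(negbK (N == 0%N)) -lt0n N_gt0.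
by rewrite subnn eqxx -(negbK (N == 0%N)) -lt0n N_gt0 opprK.
Qed.

(** Reflecting coordinate [j] permutes the vertices and negates every summand, so the sum equals its
    own opposite. *)
Lemma sum_vsign j : \sum_(v in vertices d N) vsign v j = 0.
Proof.
suff : \sum_(v in vertices d N) vsign v j
     = - \sum_(v in vertices d N) vsign v j by lra.
rewrite {1}(reindex_inj (inv_inj (flipK j))) -sumrN; apply: eq_big => v.
  by rewrite flip_vertices.
by rewrite flip_vertices => /vsign_flip ->; rewrite eqxx.
Qed.

Lemma sum_vsign2 i j :
  \sum_(v in vertices d N) vsign v i * vsign v j = (2 ^ d)%:R * (i == j)%:R.
Proof.
case: eqP => [->|/eqP ij].
  rewrite (eq_bigr (fun=> 1)) => [|v _]; last exact: vsign_sqr.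
  by rewrite sumr_const card_vertices mulr1.
rewrite mulr0.
(* For distinct indices, reflecting coordinate [i] negates exactly one of the two factors. *)
suff : \sum_(v in vertices d N) vsign v i * vsign v j
     = - \sum_(v in vertices d N) vsign v i * vsign v j by lra.
rewrite {1}(reindex_inj (inv_inj (flipK i))) -sumrN; apply: eq_big => v.
  by rewrite flip_vertices.
rewrite flip_vertices => vV.
by rewrite !vsign_flip // eqxx [j == i]eq_sym (negPf ij) mulNr.
Qed.

(** Parseval's identity: after expanding the square, orthogonality leaves only the diagonal
    terms. *)
Lemma sum_sqr_vsign (c : 'I_d -> R) :
  \sum_(v in vertices d N) (\sum_j c j * vsign v j) ^+ 2
  = (2 ^ d)%:R * \sum_j c j ^+ 2.
Proof.
have sqrE v : (\sum_j c j * vsign v j) ^+ 2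
    = \sum_i \sum_j c i * c j * (vsign v i * vsign v j).
  rewrite expr2 mulr_suml; apply: eq_bigr => i _.
  by rewrite mulr_sumr; apply: eq_bigr => j _; ring.
under eq_bigr do rewrite sqrE.
rewrite exchange_big mulr_sumr; apply: eq_bigr => i _ /=.
rewrite exchange_big /= (bigD1 i) //= [X in _ + X]big1 => [|j ji].
  by rewrite -mulr_sumr sum_vsign2 eqxx mulr1 addr0 mulrC expr2.
by rewrite -mulr_sumr sum_vsign2 eq_sym (negPf ji) !mulr0.
Qed.

(** Unnormalised: d N^2 times the square of [ndist], which avoids roots and divisions in the moment
    computations. *)
Definition sqdist u v : R := \sum_(j < d) ((u j)%:R - (v j)%:R) ^+ 2.

Definition mean_sqdist a : R :=
  \sum_(j < d) (((a j)%:R : R) ^+ 2 + ((a j)%:R - N%:R) ^+ 2) / 2.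

(** Half the difference of the values of (a_j - v_j)^2 at v_j = 0 and v_j = N; [mean_sqdist] sums
    the corresponding half-sums. *)
Definition sign_coef a j : R := (((a j)%:R : R) ^+ 2 - ((a j)%:R - N%:R) ^+ 2) / 2.

Lemma sqdistE a v : v \in vertices d N ->
  sqdist a v = mean_sqdist a + \sum_j sign_coef a j * vsign v j.
Proof.
move/verticesP => vP; rewrite -big_split; apply: eq_bigr => j _ /=.
rewrite /vsign /sign_coef; case: (vP j) => ->; first by rewrite eqxx; field.
by rewrite -(negbK (N == 0%N)) -lt0n N_gt0 /=; field.
Qed.

Lemma sum_sqdist a :
  \sum_(v in vertices d N) sqdist a v = (2 ^ d)%:R * mean_sqdist a.
Proof.
under eq_bigr => v vV do rewrite (sqdistE a vV).
rewrite big_split /= sumr_const card_vertices -[_ *+ _]mulr_natl exchange_big /=.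
by rewrite [X in _ + X]big1 ?addr0 // => j _; rewrite -mulr_sumr sum_vsign mulr0.
Qed.

Lemma variance_sqdist_le a :
  \sum_(v in vertices d N) (sqdist a v - mean_sqdist a) ^+ 2
  <= (2 ^ d)%:R * (N%:R ^+ 2 / 2 * mean_sqdist a).
Proof.
under eq_bigr => v vV do rewrite (sqdistE a vV) addrC addKr.
rewrite sum_sqr_vsign ler_wpM2l // mulr_sumr; apply: ler_sum => j _.
rewrite /sign_coef.
have x0 : 0 <= (a j)%:R :> R by [].
have xN : (a j)%:R <= N%:R :> R by rewrite ler_nat -ltnS ltn_ord.
set x : R := _%:R in x0 xN *; set n : R := N%:R in xN *.
rewrite -subr_ge0.
(* The comparison holds coordinate by coordinate, the gap being nonnegative because 0 <= x <= n. *)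
have -> : n ^+ 2 / 2 * ((x ^+ 2 + (x - n) ^+ 2) / 2)
     - ((x ^+ 2 - (x - n) ^+ 2) / 2) ^+ 2 = n ^+ 2 / 2 * (x * (n - x)) by field.
by rewrite mulr_ge0 ?mulr_ge0 ?subr_ge0 ?sqr_ge0 ?invr_ge0.
Qed.

Lemma mean_sqdist_gt0 a : (0 < d)%N -> 0 < mean_sqdist a.
Proof.
move=> d_gt0; rewrite /mean_sqdist (bigD1 (Ordinal d_gt0)) //=.
have N0 : 0 < N%:R :> R by rewrite ltr0n.
apply: ltr_pwDl.
  (* x^2 + (x - N)^2 = ((2x - N)^2 + N^2) / 2, which is positive. *)
  set x : R := (a _)%:R; have := sqr_ge0 (2 * x - N%:R).
  by have := exprn_gt0 2 N0; nra.
by apply: sumr_ge0 => j _; rewrite divr_ge0 ?addr_ge0 ?sqr_ge0.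
Qed.

Lemma mean_sqdist_vertex a : a \in vertices d N ->
  mean_sqdist a = d%:R * N%:R ^+ 2 / 2.
Proof.
move/verticesP => aP; rewrite /mean_sqdist (eq_bigr (fun=> N%:R ^+ 2 / 2)).
  by rewrite sumr_const card_ord -[_ *+ d]mulr_natl mulrA.
by move=> j _; case: (aP j) => ->; field.
Qed.

End Moments.
End Vertices.

(** * Markov and Chebyshev bounds for vertices at atypical distance *)

Lemma markov_card_le (R : realFieldType) (T : finType) (A : {set T}) (F : T -> R)
    (t : R) :
  (forall x, x \in A -> 0 <= F x) ->
  #|[set x in A | t <= F x]|%:R * t <= \sum_(x in A) F x.
Proof.
move=> F0; rewrite mulr_natl -sumr_const [leRHS](big_setID [set x | t <= F x]) /=.
have -> : [set x in A | t <= F x] = A :&: [set x | t <= F x].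
  by apply/setP=> x; rewrite !inE.
rewrite -[leLHS]addr0 lerD //.
  by apply: ler_sum => x; rewrite !inE => /andP[].
by apply: sumr_ge0 => x; rewrite !inE => /andP[_ /F0].
Qed.

Section Concentration.
Variables (R : realType) (d N : nat).
Hypotheses (d_gt0 : (0 < d)%N) (N_gt0 : (0 < N)%N).
Implicit Types (u v a : cube d N).

Let dN_gt0 : 0 < d%:R * N%:R ^+ 2 :> R.
Proof. by rewrite mulr_gt0 ?exprn_gt0 ?ltr0n. Qed.

Lemma ndist_sqr u v : ndist R u v ^+ 2 = sqdist R u v / (d%:R * N%:R ^+ 2).
Proof.
have S0 : 0 <= sqdist R u v by apply: sumr_ge0 => j _; rewrite sqr_ge0.
by rewrite /ndist exprMn exprVn exprMn (sqr_sqrtr S0) sqr_sqrtr // mulrC.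
Qed.

Lemma mean_sq_distE a :
  mean_sq_dist R a = mean_sqdist R a / (d%:R * N%:R ^+ 2).
Proof.
rewrite /mean_sq_dist; under eq_bigr do rewrite ndist_sqr.
rewrite -mulr_suml sum_sqdist // natrX mulrA mulKf //.
by rewrite expf_neq0 // pnatr_eq0.
Qed.

(** This makes the window around 1/sqrt 2 for the third side the same as the window around the root
    mean square distance from a vertex. *)
Lemma mean_sq_dist_vertex a : a \in vertices d N -> mean_sq_dist R a = 1 / 2.
Proof.
move=> aV; rewrite mean_sq_distE mean_sqdist_vertex //.
by rewrite mulrAC divff ?gt_eqF.
Qed.

Definition far_vertices (r : R) a : {set cube d N} :=
  [set v in vertices d N |
    ~~ within (Num.sqrt (mean_sq_dist R a)) r (ndist R a v)].

Lemma notin_within_sqr (b r x : R) : 0 <= b -> 0 <= r -> 0 <= x ->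
  ~~ within (Num.sqrt b) r x -> r ^+ 2 * b <= (x ^+ 2 - b) ^+ 2.
Proof.
move=> b0 r0 x0; rewrite /within in_itv /= negb_and -!ltNge => far.
have := sqrtr_ge0 b; rewrite -[in X in _ -> X](sqr_sqrtr b0).
set s := Num.sqrt b in far *; move=> s0.
(* The first factor is at least r^2 by farness, the second at least s^2 since x >= 0. *)
have -> : (x ^+ 2 - s ^+ 2) ^+ 2 = (x - s) ^+ 2 * (x + s) ^+ 2 by ring.
apply: ler_pM; rewrite ?sqr_ge0 //; last by nra.
by case/orP: far => far; nra.
Qed.

Lemma card_far_vertices (r : R) a : 0 <= r ->
  #|far_vertices r a|%:R * (d%:R * r ^+ 2) <= (2 ^ d)%:R / 2.
Proof.
move=> r0; set K : R := d%:R * N%:R ^+ 2; set A := mean_sqdist R a.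
have A0 : 0 < A by apply: mean_sqdist_gt0.
have K0 : 0 < K by [].
(* Markov is applied to the squared deviation. The threshold r^2 A K is r^2 B rescaled by K^2, where
   B = A / K. *)
pose F v := (sqdist R a v - A) ^+ 2.
have sub : far_vertices r a \subset
    [set v in vertices d N | r ^+ 2 * (A * K) <= F v].
  apply/subsetP => v; rewrite !inE => /andP[-> far] /=.
  have := notin_within_sqr _ r0 _ far.
  rewrite mean_sq_distE ndist_sqr -/K -/A => /(_ (ltW (divr_gt0 A0 K0))).
  have nd0 : 0 <= ndist R a v by rewrite mulr_ge0 ?invr_ge0 ?mulr_ge0 ?sqrtr_ge0.
  move=> /(_ nd0); rewrite -mulrBl exprMn exprVn ler_pdivlMr ?exprn_gt0 //.
  suff -> : r ^+ 2 * (A / K) * K ^+ 2 = r ^+ 2 * (A * K) by [].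
  by field; rewrite gt_eqF.
have := le_trans (@markov_card_le _ _ _ F (r ^+ 2 * (A * K)) _)
  (variance_sqdist_le N_gt0 R a).
move=> /(_ (fun v _ => sqr_ge0 _)).
have : #|far_vertices r a|%:R <=
   #|[set v in vertices d N | r ^+ 2 * (A * K) <= F v]|%:R :> R.
  by rewrite ler_nat subset_leq_card.
set m : R := _%:R; set n : R := _%:R => mn nle.
have N2 : 0 < N%:R ^+ 2 :> R by rewrite exprn_gt0 ?ltr0n.
have AN : 0 < A * N%:R ^+ 2 by rewrite mulr_gt0.
(* Threshold and variance bound share the positive factor A N^2; cancelling it leaves a bound
   independent of [a] and [N]. *)
rewrite -(ler_pM2r AN).
apply: (@le_trans _ _ (n * (r ^+ 2 * (A * K)))).
  have -> : m * (d%:R * r ^+ 2) * (A * N%:R ^+ 2) = m * (r ^+ 2 * (A * K)).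
    by rewrite /K; ring.
  by rewrite ler_wpM2r // mulr_ge0 ?sqr_ge0 ?mulr_ge0 // ltW.
by apply: le_trans nle _; rewrite -/A le_eqVlt; apply/orP; left; apply/eqP; field.
Qed.

End Concentration.

(** * Counting pairs of vertices *)

Lemma card_setX_dep (T : finType) (A : {set T}) (B : T -> {set T}) :
  #|[set p : T * T | (p.1 \in A) && (p.2 \in B p.1)]| = (\sum_(x in A) #|B x|)%N.
Proof.
rewrite -sum1_card; under [RHS]eq_bigr do rewrite -sum1_card.
by rewrite pair_big_dep /=; apply: eq_bigl => p; rewrite inE.
Qed.

(** A degenerate pair has first entry [a], second entry [a], or equal entries; each family has at
    most P = 2^d pairs. Then 3 P <= P^2 / 2 because P >= 8. *)
Lemma card_triangles (d N : nat) (a : cube d N) : (0 < N)%N -> (3 <= d)%N ->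
  (2 ^ d * 2 ^ d <= 2 * #|triangles a|)%N.
Proof.
move=> N0 d3; set V := vertices d N.
have cV : #|V| = (2 ^ d)%N := card_vertices _ N0.
have sub : setX V V \subset triangles a :|: (setX [set a] V :|: setX V [set a]
    :|: [set (v, v) | v in V]).
  apply/subsetP => -[u v]; rewrite in_setX => /andP[uV vV].
  rewrite !in_setU !in_setX !in_set1 /triangles in_set in_setX uV vV /=.
  rewrite [a == u]eq_sym [a == v]eq_sym.
  case: (eqVneq u a) => //= _; case: (eqVneq v a) => //= _.
  by case: (eqVneq u v) => //= <-; rewrite (imset_f (fun v => (v, v))).
have le_card := leq_trans (subset_leq_card sub) (leq_card_setU _ _).
rewrite cardsX cV in le_card.
have h8 : (8 <= 2 ^ d)%N by rewrite -[8%N]/(2 ^ 3)%N leq_exp2l.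
have h : (#|setX [set a] V :|: setX V [set a] :|: [set (v, v) | v in V]|
   <= 2 ^ d + 2 ^ d + 2 ^ d)%N.
  apply: leq_trans (leq_card_setU _ _) _; apply: leq_add.
    apply: leq_trans (leq_card_setU _ _) _.
    by rewrite !cardsX cards1 mul1n muln1 cV.
  by rewrite -cV leq_imset_card.
have {h}le_card := leq_trans le_card (leq_add (leqnn _) h).
by move: (2 ^ d)%N #|_| h8 le_card => P t; nia.
Qed.

Theorem theorem4p2 (R : realType) (eta : R) (eta_gt0 : 0 < eta)
    (eta_lt : eta < 1 / 2) (d N : nat) (hd : (6 <= d)%N) (hN : (1 <= N)%N)
    (a : cube d N) :
  1 - 3 / (d%:R `^ (1 - 2 * eta)) <=
    #|near_isosceles eta a|%:R / #|triangles a|%:R :> R.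
Proof.
have d0 : (0 < d)%N by apply: leq_trans hd.
have dR0 : 0 < d%:R :> R by rewrite ltr0n.
pose r : R := 1 / (d%:R `^ eta).
have r0 : 0 <= r by rewrite divr_ge0 ?powR_ge0.
set q := d%:R `^ (1 - 2 * eta).
have q0 : 0 < q by rewrite powR_gt0.
have rq : d%:R * r ^+ 2 = q.
  rewrite /q powRB ?(lt0r_neq0 dR0) ?implybT //.
  by rewrite powRr1 ?ler0n // [2 * _]mulrC powRrM powR_mulrn ?powR_ge0 //
    /r mul1r exprVn.
set V := vertices d N; set T := triangles a; set G := near_isosceles eta a.
have cV : #|V| = (2 ^ d)%N := card_vertices _ hN.
have far_le (x : cube d N) : #|far_vertices r x|%:R * q <= (2 ^ d)%:R / 2.
  by rewrite -rq card_far_vertices.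
(* Pairs with a bad third side: the first vertex serves as the centre, so the one-point bound is
   summed over all centres in [V]. *)
pose far_pairs := [set p : cube d N * cube d N |
  (p.1 \in V) && (p.2 \in far_vertices r p.1)].
have sub : T \subset G :|: (setX (far_vertices r a) V
    :|: setX V (far_vertices r a) :|: far_pairs).
  apply/subsetP => -[u v] uvT; rewrite !in_setU /G /near_isosceles in_set uvT.
  move: uvT; rewrite in_set in_setX /= => /andP[/andP[uV vV] _].
  have farE x w : w \in V -> (w \in far_vertices r x) =
      ~~ within (Num.sqrt (mean_sq_dist R x)) r (ndist R x w).
    by move=> wV; rewrite in_set wV.
  rewrite !in_setX [_ \in far_pairs]in_set /= !farE // uV vV -/r.
  have -> : Num.sqrt (mean_sq_dist R u) = 1 / Num.sqrt 2.
    by rewrite mean_sq_dist_vertex // !mul1r sqrtrV.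
  (* A triangle failing any one of the three window conditions lies in the matching bad family. *)
  by do 3![case: (within _ _ _)].
have far_pairs_le : #|far_pairs|%:R * q <= (2 ^ d)%:R * ((2 ^ d)%:R / 2).
  rewrite card_setX_dep natr_sum mulr_suml.
  apply: le_trans (ler_sum _ (fun x _ => far_le x)) _.
  by rewrite sumr_const cV -[leLHS]mulr_natl.
have TG : #|T|%:R <= #|G|%:R + (#|far_vertices r a|%:R * (2 ^ d)%:R
    + (2 ^ d)%:R * #|far_vertices r a|%:R + #|far_pairs|%:R) :> R.
  rewrite -!natrM -!natrD ler_nat -cV -!cardsX.
  apply: leq_trans (subset_leq_card sub) _.
  apply: leq_trans (leq_card_setU _ _) _; rewrite leq_add2l.
  apply: leq_trans (leq_card_setU _ _) _; rewrite leq_add2r.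
  exact: leq_card_setU.
have T2 : (2 ^ d)%:R * (2 ^ d)%:R <= 2 * #|T|%:R :> R.
  by rewrite -!natrM ler_nat card_triangles // (leq_trans _ hd).
have P0 : 0 < (2 ^ d)%:R :> R by rewrite ltr0n expn_gt0.
have fa := far_le a.
move: TG T2 P0 fa far_pairs_le.
set t : R := #|T|%:R; set g : R := #|G|%:R; set P : R := (2 ^ d)%:R.
set f : R := #|far_vertices _ _|%:R; set p : R := #|far_pairs|%:R.
move=> TG T2 P0 fa fp.
(* Positivity makes the proportion a genuine quotient, so the goal can be multiplied by [t]. *)
have t0 : 0 < t by nra.
rewrite ler_pdivlMr // mulrBl mul1r lerBlDl.
(* After multiplication by [q], each of the three bad families contributes at most P^2 / 2, in total
   3 P^2 / 2 <= 3 t by [T2]. *)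
rewrite -(ler_pM2r q0) mulrDl.
have -> : 3 / q * t * q = 3 * t by field; rewrite gt_eqF.
have : t * q <= (g + (f * P + P * f + p)) * q by rewrite ler_pM2r.
have : P * (f * q) <= P * (P / 2) by rewrite ler_pM2l.
nra.
Qed.
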